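(* Let $X$ be a Banach lattice with order-continuous norm and let $f:[0,1]\to X$ be a bounded function, in the sense that there is $M\in X$ with $|f(t)|\le M$ for all $t\in[0,1]$. Then $f$ is (oBH)-integrable on $[0,1]$ if and only if $f$ is (oB)-integrable on $[0,1]$.
   Context: $[0,1]$ carries Lebesgue measure $\lambda$. $|\cdot|$ denotes the modulus of the Banach lattice $X$. An $(o)$-sequence in $X$ is a decreasing sequence $(p_n)_n$ of elements of $X$ with $\inf_n p_n=0$. A gauge on $[0,1]$ is a map $\gamma:[0,1]\to(0,+\infty)$; it is measurable if it is Lebesgue measurable. A free partition of $[0,1]$ is a finite family $P=\{(t_i,E_i): i=1,\dots,k\}$ where $E_1,\dots,E_k$ are pairwise non-overlapping subintervals (their pairwise intersections are $\lambda$-null) with union $[0,1]$ and $t_i\in[0,1]$ (the tags $t_i$ need not belong to $E_i$). It is a Perron-type (or Henstock) partition if moreover $t_i\in E_i$ for all $i$. $P$ is $\gamma$-fine if $|w-t_i|<\gamma(t_i)$ for every $w\in E_i$ and every $i$. Set $\sigma(f,P)=\sum_{i=1}^k f(t_i)\lambda(E_i)$. A function $f:[0,1]\to X$ is order-Birkhoff integrable ((oB)-integrable) if there exist $J\in X$, an $(o)$-sequence $(p_n)_n$ in $X$ and a corresponding sequence $(\gamma_n)_n$ of measurable gauges on $[0,1]$ such that for every $n$ and every $\gamma_n$-fine free partition $P$ of $[0,1]$ one has $|\sigma(f,P)-J|\le p_n$. It is (oBH)-integrable (order-Henstock-Birkhoff integrable) if the same holds with only $\gamma_n$-fine Perron-type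 partitions $P$ allowed. *)

(* Defs.v *)
From HB Require Import structures.
From mathcomp Require Import all_boot all_order all_algebra.
From mathcomp Require Import all_classical all_reals all_analysis.

Set Implicit Arguments.
Unset Strict Implicit.
Unset Printing Implicit Defensive.

Import Order.TTheory GRing.Theory Num.Theory.
Import numFieldNormedType.Exports.

Local Open Scope classical_set_scope.
Local Open Scope ring_scope.

(* The order is part of the mixin, instead of being inherited from
   Order.Lattice: Hierarchy Builder cannot join Order.Lattice with
   CompleteNormedModule after Num.RealDomain, which already inherits from
   lattices and normed groups, has been declared. The Order.Lattice instance
   is derived just below. *)
HB.mixin Record CompleteNormedModule_isBanachLattice (R : realType) X
    of CompleteNormedModule R X := {
  bl_le : rel X ;
  bl_meet : X -> X -> X ;
  bl_join : X -> X -> X ;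
  bl_le_refl : reflexive bl_le ;
  bl_le_anti : antisymmetric bl_le ;
  bl_le_trans : transitive bl_le ;
  bl_meetP : forall x y z,
    bl_le x (bl_meet y z) = bl_le x y && bl_le x z ;
  bl_joinP : forall x y z,
    bl_le (bl_join x y) z = bl_le x z && bl_le y z ;
  bl_leD2r : forall z x y, bl_le x y -> bl_le (x + z) (y + z) ;
  bl_scaler_ge0 : forall (a : R) x, 0 <= a -> bl_le 0 x -> bl_le 0 (a *: x) ;
  bl_le_norm : forall x y,
    bl_le (bl_join x (- x)) (bl_join y (- y)) -> `|x| <= `|y|
}.

#[short(type="banachLatticeType")]
HB.structure Definition BanachLattice (R : realType) :=
  { X of CompleteNormedModule R X
       & CompleteNormedModule_isBanachLattice R X }.

#[non_forgetful_inheritance]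
HB.instance Definition _ (R : realType) (X : banachLatticeType R) :=
  Order.Le_isPOrder.Build ring_display (BanachLattice.sort X)
    bl_le_refl bl_le_anti bl_le_trans.

#[non_forgetful_inheritance]
HB.instance Definition _ (R : realType) (X : banachLatticeType R) :=
  Order.POrder_MeetJoin_isLattice.Build ring_display (BanachLattice.sort X)
    bl_meetP bl_joinP.

(* The modulus of X; `|x| is the norm. *)
Definition modulus (R : realType) (X : banachLatticeType R) (x : X) : X :=
  Order.join x (- x).

(* Every net (indexed by a nonempty directed preordered set) that decreases
   to 0 converges to 0 in norm. *)
Definition order_continuous_norm (R : realType) (X : banachLatticeType R) :
    Prop :=
  forall (I : Type) (leI : I -> I -> Prop) (u : I -> X),
    inhabited I ->
    (forall i, leI i i) ->
    (forall i j k, leI i j -> leI j k -> leI i k) ->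
    (forall i j, exists k, leI i k /\ leI j k) ->
    (forall i j, leI i j -> u j <= u i) ->
    infimums (range u) 0 ->
  forall e : R, 0 < e -> exists i0, forall i, leI i0 i -> `|u i| < e.

Definition o_sequence (R : realType) (X : banachLatticeType R)
    (p : nat -> X) : Prop :=
  nonincreasing_seq p /\ infimums (range p) 0.

(* Real numbers with the sigma-algebra of Lebesgue measurable sets, which is
   the domain of completed_lebesgue_measure; measurableTypeR R carries only
   the Borel sets. *)
Definition lebesgueTypeR (R : realType) :=
  caratheodory_type (@wlength R idfun)^*%mu.

(* Functions on [0, 1] are represented by functions on R of which only the
   values on [0, 1] matter. *)
Definition measurable_gauge (R : realType) (g : R -> R) : Prop :=
  (forall t, t \in `[0, 1] -> 0 < g t) /\
  measurable_fun (`[0, 1]%classic : set (lebesgueTypeR R))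
    (g : lebesgueTypeR R -> measurableTypeR R).

Definition free_partition (R : realType) (k : nat)
    (t : 'I_k -> R) (E : 'I_k -> set R) : Prop :=
  [/\ forall i, t i \in `[0, 1],
      forall i, is_interval (E i),
      forall i j, i != j -> lebesgue_measure (E i `&` E j) = 0%E
    & \bigcup_i E i = `[0, 1]%classic].

Definition perron_partition (R : realType) (k : nat)
    (t : 'I_k -> R) (E : 'I_k -> set R) : Prop :=
  free_partition t E /\ forall i, E i (t i).

Definition gauge_fine (R : realType) (g : R -> R) (k : nat)
    (t : 'I_k -> R) (E : 'I_k -> set R) : Prop :=
  forall i w, E i w -> `|w - t i| < g (t i).

Definition riemann_sum (R : realType) (X : banachLatticeType R) (f : R -> X)
    (k : nat) (t : 'I_k -> R) (E : 'I_k -> set R) : X :=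
  \sum_(i < k) fine (lebesgue_measure (E i)) *: f (t i).

Definition oB_integrable (R : realType) (X : banachLatticeType R)
    (f : R -> X) : Prop :=
  exists (J : X) (p : nat -> X) (g : nat -> R -> R),
    [/\ o_sequence p,
        forall n, measurable_gauge (g n)
      & forall n k (t : 'I_k -> R) (E : 'I_k -> set R),
          free_partition t E -> gauge_fine (g n) t E ->
          modulus (riemann_sum f t E - J) <= p n].

Definition oBH_integrable (R : realType) (X : banachLatticeType R)
    (f : R -> X) : Prop :=
  exists (J : X) (p : nat -> X) (g : nat -> R -> R),
    [/\ o_sequence p,
        forall n, measurable_gauge (g n)
      & forall n k (t : 'I_k -> R) (E : 'I_k -> set R),
          perron_partition t E -> gauge_fine (g n) t E ->
          modulus (riemann_sum f t E - J) <= p n].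

(* Main.v *)
Require Import Defs.
From HB Require Import structures.
From mathcomp Require Import all_boot all_order all_algebra.
From mathcomp Require Import all_classical all_reals all_analysis.
From mathcomp Require Import measurable_realfun lra.

Set Implicit Arguments.
Unset Strict Implicit.
Unset Printing Implicit Defensive.

Import Order.TTheory GRing.Theory Num.Theory.
Import numFieldNormedType.Exports.

Local Open Scope classical_set_scope.
Local Open Scope ring_scope.

(** The integral over Perron-type partitions forces the integral over free
    partitions because the order estimate |sigma(f, P) - J| <= p is convex in
    the values of f, so that it survives averaging over the choice of tags.

    Fix one gauge g of the Perron-type integral, its bound p, and e > 0. The
    set where g < c has outer measure less than e / 4 for some c > 0
    ([small_gauge_set]), and there is one division of [0, 1] into cells shorter
    than c, with tags in the cells, which is g-fine ([cousin_division]).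
    Replacing the tag of any cell by any other point of the same cell where
    g >= c keeps it Perron-type and g-fine, so every Riemann sum obtained by
    such replacements is within p of J. An open set U with measure at most
    e / 2 contains the points where g < c and the finitely many endpoints S of
    the cells ([small_open_cover]). The new gauge is the distance to S outside
    U, and the distance to the complement of U inside U. In a free partition
    fine for it, a piece with tag outside U lies in the cell of its tag, while
    the pieces with tag in U have total length at most e / 2.

    Consequently the part of the free Riemann sum over tags outside U is
    almost an average of the sums above: in each cell, the tag of a piece gets
    the length of the piece as its weight, and the old tag of the cell gets the
    remaining length. The remaining lengths add up to the total length of the
    pieces with tag in U, so both corrections are at most (e / 2) M, and
    |sigma(f, P) - J| <= p + e M ([retagged_sum_le],
    [free_gauge_of_perron_gauge]). With e = 1 / (n + 1), the bounds
    p_n + M / (n + 1) form an (o)-sequence since a Banach lattice is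
    Archimedean ([banach_lattice_archimedean]). *)

(** * Order and norm in a Banach lattice *)

Lemma bl_leBlDr (R : realType) (X : banachLatticeType R) (x y z : X) :
  (x - z <= y) = (x <= y + z).
Proof.
apply/idP/idP => h; first by rewrite -[x](subrK z); exact: bl_leD2r.
by rewrite -[y](addrK z); exact: bl_leD2r.
Qed.

Lemma bl_subr_ge0 (R : realType) (X : banachLatticeType R) (x y : X) :
  (0 <= y - x) = (x <= y).
Proof.
apply/idP/idP => h; first by move: (bl_leD2r x _ _ h); rewrite add0r subrK.
by move: (bl_leD2r (- x) _ _ h); rewrite subrr.
Qed.

Lemma bl_leBrDr (R : realType) (X : banachLatticeType R) (x y z : X) :
  (x <= y - z) = (x + z <= y).
Proof. by rewrite -[z in RHS]opprK bl_leBlDr. Qed.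

Lemma bl_leD (R : realType) (X : banachLatticeType R) (x y z t : X) :
  x <= y -> z <= t -> x + z <= y + t.
Proof.
move=> xy zt; apply: (le_trans (bl_leD2r z _ _ xy)).
by rewrite ![y + _]addrC; exact: bl_leD2r.
Qed.

Lemma bl_ler_sum (R : realType) (X : banachLatticeType R) (I : Type)
    (r : seq I) (P : pred I) (F G : I -> X) :
  (forall i, P i -> F i <= G i) ->
  \sum_(i <- r | P i) F i <= \sum_(i <- r | P i) G i.
Proof.
move=> FG; elim/big_ind2 : _ => // x1 x2 y1 y2; exact: bl_leD.
Qed.

Lemma bl_leZ (R : realType) (X : banachLatticeType R) (a : R) (x y : X) :
  0 <= a -> x <= y -> a *: x <= a *: y.
Proof.
move=> a0 xy; rewrite -bl_subr_ge0 -scalerBr; apply: bl_scaler_ge0 => //.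
by apply: (_ : 0 <= y - x); rewrite bl_subr_ge0.
Qed.

Lemma bl_leZl (R : realType) (X : banachLatticeType R) (a b : R) (x : X) :
  0 <= x -> a <= b -> a *: x <= b *: x.
Proof.
move=> x0 ab; rewrite -bl_subr_ge0 -scalerBl; apply: bl_scaler_ge0 => //.
by rewrite subr_ge0.
Qed.

Lemma modulus_le (R : realType) (X : banachLatticeType R) (x y : X) :
  (modulus x <= y) = (x <= y) && (- x <= y).
Proof. exact: leUx. Qed.

Lemma modulus_ge0 (R : realType) (X : banachLatticeType R) (x : X) :
  0 <= modulus x.
Proof.
have := bl_leD (leUl x (- x)) (leUr (- x) x).
rewrite subrr -/(modulus x) -mulr2n -scaler_nat => h.
suff : 0 <= 2^-1 *: (2%:R *: modulus x).
  by rewrite scalerA mulVf ?pnatr_eq0// scale1r.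
by rewrite -[X in X <= _](scaler0 _ 2^-1); apply: bl_leZ; rewrite ?invr_ge0.
Qed.

Lemma modulus_ge0_id (R : realType) (X : banachLatticeType R) (x : X) :
  0 <= x -> modulus x = x.
Proof.
move=> x0; apply/join_idPl.
by apply: (le_trans _ x0); move: (bl_leD2r (- x) _ _ x0); rewrite add0r subrr.
Qed.

(** The positive part u of x satisfies 0 <= u <= |y| / (n + 1) for every n, so
    its norm is 0 because the norm is monotone. *)
Lemma banach_lattice_archimedean (R : realType) (X : banachLatticeType R)
    (x y : X) :
  (forall n, x <= n.+1%:R^-1 *: y) -> x <= 0.
Proof.
move=> xy; pose u : X := Order.join x 0; pose v := modulus y.
have u0 : 0 <= u by exact: leUr.
have v0 : 0 <= v by exact: modulus_ge0.
have yv : y <= v by exact: leUl.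
have uv n : `|u| <= n.+1%:R^-1 * `|v|.
  have n0 : 0 <= n.+1%:R^-1 :> R by rewrite invr_ge0.
  have nv0 : 0 <= n.+1%:R^-1 *: v.
    by rewrite -[leLHS](scaler0 _ n.+1%:R^-1) bl_leZ.
  rewrite -[n.+1%:R^-1]ger0_norm// -normrZ; apply: bl_le_norm.
  apply: (_ : modulus u <= modulus (n.+1%:R^-1 *: v)).
  rewrite !modulus_ge0_id// leUx nv0 andbT.
  by apply: le_trans (xy n) _; exact: bl_leZ.
suff /eqP u00 : u == 0 by rewrite -u00; exact: leUl.
rewrite -normr_eq0 eq_le normr_ge0 andbT; apply/ler_addgt0Pl => e e0.
have [v00|v00] := eqVneq `|v| 0.
  by rewrite (le_trans (uv 0%N))// v00 mulr0 addr0 ltW.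
have vgt0 : 0 < `|v| by rewrite lt_neqAle eq_sym v00/=.
have [k] := ltr_add_invr (divr_gt0 e0 vgt0).
rewrite addr0 add0r ltr_pdivlMr// => /ltW; exact: le_trans (uv k).
Qed.

(** A lower bound z of p n + q n also satisfies z - q m <= p n for all m and n,
    by monotonicity at the index max(n, m); taking the infimum over n, then
    over m, gives z <= 0. *)
Lemma o_sequenceD (R : realType) (X : banachLatticeType R) (p q : nat -> X) :
  o_sequence p -> o_sequence q -> o_sequence (fun n => p n + q n).
Proof.
move=> [pd [p0 pinf]] [qd [q0 qinf]]; split.
  by move=> m n mn; apply: bl_leD; [exact: pd|exact: qd].
split=> [_ [n _ <-]|z lz].
  by rewrite -[leLHS]addr0; apply: bl_leD; [apply: p0|apply: q0]; exists n.
apply: qinf => _ [m _ <-].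
rewrite -[z](subrK (q m)) -[leRHS]add0r; apply: bl_leD => //.
apply: pinf => _ [n _ <-]; rewrite bl_leBlDr.
apply: (@le_trans _ _ (p (maxn n m) + q (maxn n m))).
  by apply: lz; exists (maxn n m).
by apply: bl_leD; [apply: pd; exact: leq_maxl|apply: qd; exact: leq_maxr].
Qed.

Lemma o_sequence_harmonic (R : realType) (X : banachLatticeType R) (y : X) :
  0 <= y -> o_sequence (fun n => n.+1%:R^-1 *: y).
Proof.
move=> y0; split; first move=> m n mn.
  by apply: bl_leZl => //; rewrite lef_pV2 ?posrE// ler_nat ltnS.
split=> [_ [n _ <-]|z lz].
  by rewrite -[leLHS](scaler0 _ n.+1%:R^-1) bl_leZ// invr_ge0.
by apply: (@banach_lattice_archimedean _ _ _ y) => n; apply: lz; exists n.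
Qed.

(** The hypothesis on y says that y j lies below every upper bound of D j, as
    a convex combination of elements of D j does. It is stated with upper
    bounds since D j need not have a supremum. Moving all terms but one to the
    right-hand side frees the coordinates one at a time. *)
Lemma sum_le_of_selections (R : realType) (X : banachLatticeType R) (N : nat)
    (D : 'I_N -> set X) (y : 'I_N -> X) (c : X) :
  (forall j b, ubound (D j) b -> y j <= b) ->
  (forall v, (forall j, D j (v j)) -> \sum_j v j <= c) ->
  \sum_j y j <= c.
Proof.
elim: N => [|N IH] in D y c *.
  by move=> _ /(_ y); rewrite !big_ord0; apply; case.
move=> Dy Dc; rewrite big_ord_recl addrC -bl_leBrDr.
apply: (IH (fun j => D (lift ord0 j))) => [j b|v vD]; first exact: Dy.
rewrite bl_leBrDr addrC -bl_leBrDr; apply: Dy => x Dx; rewrite bl_leBrDr.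
have := Dc (fun j => oapp v x (unlift ord0 j)).
rewrite big_ord_recl unlift_none/=.
under eq_bigr do rewrite liftK/=.
by apply=> j; case: unliftP => [k|] ->.
Qed.

(** * Distance to a set *)

Definition dist_set (R : realType) (A : set R) (z : R) : R :=
  inf [set `|z - a| | a in A].

Lemma dist_set_le (R : realType) (A : set R) (z a : R) :
  A a -> dist_set A z <= `|z - a|.
Proof.
by move=> Aa; apply: ge_inf; [exists 0 => _ [b _ <-]|exists a].
Qed.

Lemma dist_set_lipschitz (R : realType) (A : set R) (z w : R) :
  A !=set0 -> dist_set A z <= `|z - w| + dist_set A w.
Proof.
move=> [a Aa]; rewrite -lerBlDl; apply: lb_le_inf; first by exists `|w - a|, a.
move=> _ [b Ab <-]; rewrite lerBlDl (le_trans (dist_set_le z Ab))//.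
by rewrite (le_trans _ (ler_normD _ _))// addrA subrK.
Qed.

Lemma dist_set_gt0 (R : realType) (A : set R) (z : R) :
  closed A -> A !=set0 -> ~ A z -> 0 < dist_set A z.
Proof.
move=> cA [a Aa] nAz.
have /nbhs_ballP[e /= e0 zA] : nbhs z (~` A).
  by apply: open_nbhs_nbhs; split => //; exact: closed_openC.
apply: (lt_le_trans e0); apply: lb_le_inf; first by exists `|z - a|, a.
by move=> _ [b Ab <-]; rewrite leNgt; apply/negP => zb; exact: (zA b).
Qed.

Lemma dist_set_continuous (R : realType) (A : set R) :
  A !=set0 -> continuous (dist_set A).
Proof.
move=> A0 z; apply/cvgrPdist_lt => e e0; near=> w.
have zw : `|z - w| < e by near: w; apply: cvgr_dist_lt.
apply: le_lt_trans zw; rewrite ler_norml.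
have := dist_set_lipschitz z w A0; have := dist_set_lipschitz w z A0.
rewrite distrC; move: `|z - w| (dist_set A z) (dist_set A w) => d a b ba ab.
by apply/andP; split; lra.
Unshelve. all: by end_near. Qed.

(** * Lebesgue measure *)

Lemma measure_bigsetU_null (R : realType) (d : measure_display)
    (T : measurableType d) (mu : {measure set T -> \bar R}) (I : choiceType)
    (r : seq I) (E : I -> set T) :
  (forall i, measurable (E i)) -> uniq r ->
  (forall i j, i != j -> mu (E i `&` E j) = 0%E) ->
  mu (\big[setU/set0]_(i <- r) E i) = (\sum_(i <- r) mu (E i))%E.
Proof.
move=> mE + E0; elim: r => [|i r IH]; first by rewrite !big_nil measure0.
rewrite /= !big_cons => /andP[ir ur]; rewrite -IH//.
have mU (s : seq I) : measurable (\big[setU/set0]_(j <- s) E j).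
  exact: bigsetU_measurable.
set U := \big[_/_]_(j <- r) _.
have EU0 : mu (E i `&` U) = 0%E.
  rewrite /U; elim: (r) ir => [|j s IHs]; first by rewrite big_nil setI0 measure0.
  rewrite in_cons negb_or big_cons setIUr => /andP[ij {}/IHs s0].
  apply/eqP; rewrite -measure_le0.
  have mi : measurable (E i `&` E j) by exact: measurableI.
  have mis : measurable (E i `&` \big[setU/set0]_(k <- s) E k).
    exact: measurableI.
  apply: (le_trans (measureU2 mu mi mis)); rewrite -[leRHS]adde0.
  by apply: leeD; rewrite le_eqVlt; apply/orP; left; apply/eqP;
    [exact: E0|exact: s0].
transitivity (mu (E i `|` (U `\` E i))).
  by congr (mu _); rewrite setDE setUIr setUv setIT.
rewrite measureU//; first last.
- by rewrite setDE setIA (setIC (E i)) -setIA setICr setI0.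
- by apply: measurableD => //; exact: mU.
congr (_ + _)%E; rewrite [RHS](measureDI mu (mU r) (mE i)) -/U.
rewrite [X in (_ + X)%E](_ : _ = 0%E) ?adde0//.
by move: EU0; rewrite setIC.
Qed.

Lemma lebesgue_measure01 (R : realType) :
  lebesgue_measure (`[0, 1]%classic : set R) = 1%E.
Proof. by rewrite lebesgue_measure_itv/= lte_fin ltr01 oppr0 adde0. Qed.

(** The sets where g < 1 / (n + 1) decrease to the empty set, since g > 0. They
    are measurable for the completed Lebesgue measure, which is the restriction
    of the outer measure; g itself need not be Borel. *)
Lemma small_gauge_set (R : realType) (g : R -> R) (e : R) :
  measurable_gauge g -> 0 < e ->
  exists2 c, 0 < c &
    ((@wlength R idfun)^*%mu [set t | t \in `[0%R, 1%R] /\ (g t < c)%R] < e%:E)%E.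
Proof.
move=> [g0 mg] e0.
pose F n : set (lebesgueTypeR R) :=
  [set t : R | t \in `[0, 1] /\ g t < n.+1%:R^-1].
have mI : measurable (`[0, 1]%classic : set (lebesgueTypeR R)).
  by apply: sub_caratheodory; exact: measurable_itv.
have mF n : measurable (F n).
  have := mg mI `]-oo, n.+1%:R^-1[%classic (measurable_itv _).
  rewrite [X in measurable X -> _](_ : _ = F n)//.
have F0 : \bigcap_n F n = set0.
  apply/seteqP; split => // t Ft.
  have [t01 _] := Ft 0%N I.
  have [k] := ltr_add_invr (g0 t t01); rewrite add0r => /ltW.
  by rewrite leNgt; have [_ ->] := Ft k I.
have IE : ((@wlength R idfun)^*%mu `[0%R, 1%R]%classic = 1)%E.
  exact: (lebesgue_measure01 R).
have F0oo : (completed_lebesgue_measure (F 0%N) < +oo)%E.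
  apply: (@le_lt_trans _ _ 1%E); last exact: ltry.
  by rewrite -IE; apply: le_outer_measure => t [].
have cv : @completed_lebesgue_measure R (F n) @[n --> \oo] --> (0 : \bar R)%E.
  rewrite -(measure0 (@completed_lebesgue_measure R)) -F0.
  apply: nonincreasing_cvg_mu => //; first by rewrite F0; exact: measurable0.
  move=> m n mn; apply/subsetPset => t [t01 gt]; split => //.
  by rewrite (lt_le_trans gt)// lef_pV2 ?posrE// ler_nat ltnS.
have e0' : (0 < e%:E)%E by rewrite lte_fin.
have [n _ /(_ n (leqnn n)) Fn] := cv _ (open_ereal_lt' e0').
by exists n.+1%:R^-1.
Qed.

Lemma small_open_cover (R : realType) (A S : set R) (e : R) :
  0 < e -> ((@wlength R idfun)^*%mu A < e%:E)%E -> countable S ->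
  exists U : set R, [/\ open U, A `<=` U, S `<=` U,
    (lebesgue_measure U <= (2 * e)%:E)%E & ~` U !=set0].
Proof.
move=> e0 Ae cS.
have [U [oU ASU Ue]] := outer_measure_open_le (A `|` S) e0.
have U2e : (lebesgue_measure U <= (2 * e)%:E)%E.
  apply: le_trans Ue _.
  rewrite (_ : 2 * e = e + e); last by lra.
  rewrite EFinD leeD2r//; apply: le_trans (outer_measureU2 _ _ _) _.
  rewrite -[leRHS]adde0; apply: leeD; first exact: ltW.
  by rewrite -[leLHS]/(lebesgue_measure S) (countable_lebesgue_measure0 cS).
exists U; split => //.
- by move=> x Ax; apply: ASU; left.
- by move=> x Sx; apply: ASU; right.
(* The whole line has infinite measure, so it is not U. *)
- apply/set0P/eqP => U0; move: U2e.
  have -> : U = `]-oo, +oo[%classic.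
    rewrite -[U]setCK U0 setC0; apply/seteqP.
    by split => // x _ /=; rewrite in_itv.
  by rewrite lebesgue_measure_itv/=.
Qed.

(** * Divisions of the unit interval *)

(** Cousin's lemma. The supremum c of the points b such that [0, b] has such a
    division is itself passed: one more cell with tag c leads from a division
    of some [0, b], with b close to c, to a point beyond c unless 1 comes
    first. *)
Lemma cousin_division (R : realType) (g : R -> R) :
  (forall t, t \in `[0, 1] -> 0 < g t) ->
  exists (N : nat) (x s : nat -> R), [/\ x 0%N = 0, x N = 1,
    forall j, (j < N)%N -> x j <= s j <= x j.+1
    & forall j, (j < N)%N -> x j.+1 - x j < g (s j)].
Proof.
move=> g0.
pose reach (b : R) := exists (N : nat) (x s : nat -> R),
  [/\ x 0%N = 0, x N = b, forall j, (j < N)%N -> x j <= s j <= x j.+1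
    & forall j, (j < N)%N -> x j.+1 - x j < g (s j)].
pose A : set R := [set b | 0 <= b <= 1 /\ reach b].
have A0 : A 0.
  split; first by rewrite lexx ler01.
  by exists 0%N, (fun=> 0), (fun=> 0).
have supA : has_sup A.
  by split; [exists 0|exists 1 => b [/andP[]]].
set c := sup A.
have c01 : 0 <= c <= 1.
  rewrite ub_le_sup//=; last exact: supA.2.
  by apply: ge_sup; [exists 0|move=> b [/andP[]]].
have gc : 0 < g c by apply: g0; rewrite in_itv.
have gc2 : 0 < g c / 2 by rewrite divr_gt0.
have [b [b01 [N [x [s [x0 xN xs xg]]]]] cb] := sup_adherent (gc2) supA.
have bc : b <= c by apply: ub_le_sup; [exact: supA.2|split => //; exists N, x, s].
pose b' := Num.min 1 (c + g c / 3).
have bb' : c <= b'.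
  by rewrite le_min; apply/andP; split; [case/andP: c01|lra].
have : A b'.
  split.
    rewrite ge_min lexx/= andbT; case/andP: c01 => c0 _.
    exact: le_trans c0 bb'.
  exists N.+1, (fun j => if (j <= N)%N then x j else b'),
    (fun j => if (j < N)%N then s j else c).
  split; rewrite ?ltnn//= => j; rewrite ltnS leq_eqVlt => /orP[/eqP->|jN] /=.
  - by rewrite eqxx ltnn/= xN bc bb'. 
  - by rewrite jN orbT; exact: xs.
  - rewrite eqxx ltnn/= xN.
    have : b' <= c + g c / 3 by rewrite ge_min lexx orbT.
    by move: cb; rewrite -/c; lra.
  - by rewrite jN orbT; exact: xg.
move=> Ab'; have b'c : b' <= c by apply: ub_le_sup => //; exact: supA.2.
have b'1 : b' = 1.
  move: b'c; rewrite /b'; case: (leP 1 (c + g c / 3)) => // _; lra.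
by move: Ab'.2; rewrite b'1.
Qed.

Lemma division_le (R : realType) (N : nat) (x s : nat -> R) :
  (forall j, (j < N)%N -> x j <= s j <= x j.+1) ->
  forall i j, (i <= j <= N)%N -> x i <= x j.
Proof.
move=> xs i; elim=> [|j IH].
  by rewrite leqn0 => /andP[/eqP->].
rewrite leq_eqVlt => /andP[/orP[/eqP->//|ij] jN].
rewrite (le_trans (IH _))//; first by rewrite -ltnS ij ltnW.
by case/andP: (xs j jN) => /le_trans; apply.
Qed.

Lemma division_cover (R : realType) (N : nat) (x : nat -> R) (t : R) :
  x 0%N <= t < x N -> exists2 j, (j < N)%N & x j <= t < x j.+1.
Proof.
elim: N => [|N IH] /andP[x0 xN]; first by move: (le_lt_trans x0 xN); rewrite ltxx.
have [tN|Nt] := ltP t (x N); last by exists N => //; rewrite Nt xN.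
by have [|j jN xj] := IH; [rewrite x0|exists j => //; exact: ltnW].
Qed.

Lemma division_perron (R : realType) (N : nat) (x s : nat -> R) :
  x 0%N = 0 -> x N = 1 ->
  (forall j, (j < N)%N -> x j <= s j <= x j.+1) ->
  forall a : 'I_N -> R, (forall j : 'I_N, x j <= a j <= x j.+1) ->
  perron_partition a (fun j : 'I_N => `[x j, x j.+1]%classic).
Proof.
move=> x0 xN xs a xa; have xle := division_le xs.
have x01 j : (j <= N)%N -> 0 <= x j <= 1.
  by move=> jN; rewrite -x0 -xN !xle ?jN ?leqnn.
split; last by move=> j /=; rewrite in_itv/=; exact: xa.
split.
- move=> j; rewrite in_itv/=.
  case/andP: (xa j) => xaj axj.
  case/andP: (x01 j (ltnW (ltn_ord j))) => p _.
  case/andP: (x01 j.+1 (ltn_ord j)) => _ q.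
  by rewrite (le_trans p)//= (le_trans axj).
- by move=> j; exact: interval_is_interval.
- move=> i j ij; wlog lij : i j ij / (i < j)%N => [wl|].
    have [/wl|/wl|/val_inj e] := ltngtP i j; first exact.
      by rewrite eq_sym setIC; exact.
    by rewrite e eqxx in ij.
  apply: (@subset_measure0 _ _ _ lebesgue_measure _ [set x j]) => //.
  + by apply: measurableI; exact: measurable_itv.
  + move=> t /=; rewrite !in_itv/= => -[/andP[_ ti] /andP[jt _]].
    apply/eqP; rewrite eq_le jt andbT (le_trans ti)// xle//.
    by rewrite lij ltnW.
  + exact: lebesgue_measure_set1.
- apply/seteqP; split => [t [j _]/=|t /=]; rewrite !in_itv/=.
    move=> /andP[jt tj].
    case/andP: (x01 j (ltnW (ltn_ord j))) => p _.
    case/andP: (x01 j.+1 (ltn_ord j)) => _ q.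
    by rewrite (le_trans p)//= (le_trans tj).
  move=> /andP[t0]; rewrite le_eqVlt => /orP[/eqP t1|t1].
    case: N => [|N] in x0 xN xs a xa xle x01 *.
      by move: xN; rewrite x0 => /eqP; rewrite eq_sym oner_eq0.
    exists ord_max => //=; rewrite in_itv/= xN t1 lexx andbT.
    by case/andP: (x01 N (leqnSn N)).
  have [|j jN /andP[xj jx]] := @division_cover _ N x t; first by rewrite x0 xN t0.
  by exists (Ordinal jN) => //=; rewrite in_itv/= xj ltW.
Qed.

(** * Lengths in a free partition *)

Lemma free_partition_measurable (R : realType) (k : nat) (t : 'I_k -> R)
    (E : 'I_k -> set R) :
  free_partition t E -> forall i, measurable (E i).
Proof. by case=> _ iE _ _ i; exact: is_interval_measurable. Qed.

Lemma free_partition_sub (R : realType) (k : nat) (t : 'I_k -> R)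
    (E : 'I_k -> set R) :
  free_partition t E -> forall i, E i `<=` `[0, 1]%classic.
Proof. by case=> _ _ _ <- i; exact: bigcup_sup. Qed.

Lemma free_partition_fin_num (R : realType) (k : nat) (t : 'I_k -> R)
    (E : 'I_k -> set R) :
  free_partition t E -> forall i, lebesgue_measure (E i) \is a fin_num.
Proof.
move=> fE i; rewrite ge0_fin_numE//; apply: (@le_lt_trans _ _ 1%E).
  rewrite -(lebesgue_measure01 R); apply: le_measure; rewrite ?inE.
  - exact: free_partition_measurable fE i.
  - exact: measurable_itv.
  - exact: free_partition_sub fE i.
exact: ltry.
Qed.

Lemma free_partition_sum_length (R : realType) (k : nat) (t : 'I_k -> R)
    (E : 'I_k -> set R) (P : pred 'I_k) :
  free_partition t E ->
  (\sum_(i | P i) fine (lebesgue_measure (E i)))%:E =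
  lebesgue_measure (\big[setU/set0]_(i <- enum P) E i).
Proof.
move=> fE; rewrite measure_bigsetU_null ?enum_uniq//; first last.
- by case: fE.
- exact: free_partition_measurable fE.
rewrite -sumEFin big_enum/=; apply: eq_bigr => i _.
by rewrite fineK// (free_partition_fin_num fE).
Qed.

Lemma free_partition_sum_length_le (R : realType) (k : nat) (t : 'I_k -> R)
    (E : 'I_k -> set R) (P : pred 'I_k) (V : set R) :
  free_partition t E -> measurable V -> (forall i, P i -> E i `<=` V) ->
  ((\sum_(i | P i) fine (lebesgue_measure (E i)))%:E <= lebesgue_measure V)%E.
Proof.
move=> fE mV EV; rewrite (free_partition_sum_length P fE).
have mE := free_partition_measurable fE.
apply: le_measure; rewrite ?inE.
- by apply: bigsetU_measurable => i _; exact: mE.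
- exact: mV.
rewrite big_enum/=; elim/big_ind : _ => [|A B AV BV|//]; first exact: sub0set.
by rewrite subUset.
Qed.

Lemma free_partition_total_length (R : realType) (k : nat) (t : 'I_k -> R)
    (E : 'I_k -> set R) :
  free_partition t E -> \sum_i fine (lebesgue_measure (E i)) = 1.
Proof.
move=> fE; apply: EFin_inj; rewrite (free_partition_sum_length xpredT fE).
rewrite -(lebesgue_measure01 R); congr (lebesgue_measure _).
case: fE => _ _ _ <-; rewrite big_enum/= -bigcup_seq.
by apply: eq_bigcupl; split => i //= _; rewrite mem_index_enum.
Qed.

(** * From Perron-type to free partitions *)

(** The combinatorial core, free of measure theory: L gives the lengths of
    cells with tags s, l those of pieces with tags t, and c sends each good
    piece to a cell that contains it. In the cell j, replacing F (s j) by the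
    average of the values of F at the good tags, weighted by l, and of F (s j),
    weighted by the remaining length r j, preserves the upper bound B valid for
    all choices of tags. What is left of the free sum are the bad pieces and
    the terms r j *: F (s j), both of total weight at most d. *)
Lemma retagged_sum_le (R : realType) (X : banachLatticeType R) (F : R -> X)
    (M B : X) (d : R) (N k : nat) (L s : 'I_N -> R) (l t : 'I_k -> R)
    (c : 'I_k -> 'I_N) (good : pred 'I_k) :
  (forall i, 0 <= l i) ->
  (forall j, \sum_(i | good i && (c i == j)) l i <= L j) ->
  \sum_j L j = \sum_i l i ->
  \sum_(i | ~~ good i) l i <= d ->
  0 <= M -> (forall i, F (t i) <= M) -> (forall j, - F (s j) <= M) ->
  (forall a : 'I_N -> R,
    (forall j, a j = s j \/ exists i, [/\ good i, c i = j & a j = t i]) ->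
    \sum_j L j *: F (a j) <= B) ->
  \sum_i l i *: F (t i) <= B + (2 * d) *: M.
Proof.
move=> l0 lL Ll ld M0 tM sM aB.
pose r j := L j - \sum_(i | good i && (c i == j)) l i.
have r0 j : 0 <= r j by rewrite subr_ge0.
have rE : \sum_j r j = \sum_(i | ~~ good i) l i.
  rewrite sumrB Ll -(partition_big c xpredT)//= (bigID good)/=.
  by rewrite addrC addrK.
pose y j := \sum_(i | good i && (c i == j)) l i *: F (t i) + r j *: F (s j).
have yB : \sum_j y j <= B.
  pose T j := [set a | a = s j \/ exists i, [/\ good i, c i = j & a = t i]].
  apply: (@sum_le_of_selections _ _ _ (fun j => [set L j *: F a | a in T j])).
    move=> j b Tb.
    have {}Tb a : T j a -> L j *: F a <= b by move=> Ta; apply: Tb; exists a.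
    have : 0 <= L j by rewrite (le_trans _ (lL j))// sumr_ge0.
    (* A cell of length 0 contributes 0, and division by L j is possible in
       all others. *)
    rewrite le_eqVlt => /orP[/eqP L0|L0].
      have S0 : \sum_(i | good i && (c i == j)) l i = 0.
        by apply/eqP; rewrite eq_le [leRHS]L0 lL sumr_ge0.
      rewrite /y /r S0 -L0 subrr scale0r addr0 big1.
        by have := Tb (s j) (or_introl erefl); rewrite -L0 scale0r.
      by move=> i ij; rewrite (psumr_eq0P _ S0)// scale0r.
    have {}Tb a : T j a -> F a <= (L j)^-1 *: b.
      move=> /Tb /(bl_leZ (_ : 0 <= (L j)^-1)).
      by rewrite scalerA mulVf ?gt_eqF// scale1r; apply; rewrite invr_ge0 ltW.
    have -> : b = \sum_(i | good i && (c i == j)) l i *: ((L j)^-1 *: b)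
        + r j *: ((L j)^-1 *: b).
      rewrite -scaler_suml -scalerDl /r addrC subrK scalerA.
      by rewrite divff ?gt_eqF// scale1r.
    apply: bl_leD.
      apply: bl_ler_sum => i /andP[gi /eqP ci]; apply: bl_leZ => //.
      by apply: Tb; right; exists i.
    by apply: bl_leZ => //; apply: Tb; left.
  move=> v Tv.
  have /choice[a aT] : forall j, exists a, T j a /\ L j *: F a = v j.
    by move=> j; have [a] := Tv j; exists a.
  have := aB a (fun j => (aT j).1).
  by under eq_bigr do rewrite (aT _).2.
have -> : \sum_i l i *: F (t i) = \sum_j y j +
    (\sum_(i | ~~ good i) l i *: F (t i) + \sum_j r j *: - F (s j)).
  rewrite big_split/= -(partition_big c xpredT)//= (bigID good)/=.
  under [X in _ = _ + (_ + X)]eq_bigr do rewrite scalerN.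
  by rewrite sumrN addrACA subrr addr0.
apply: bl_leD yB _.
apply: (@le_trans _ _ (\sum_(i | ~~ good i) l i *: M + \sum_j r j *: M)).
  by apply: bl_leD; apply: bl_ler_sum => *; exact: bl_leZ.
by rewrite -!scaler_suml -scalerDl rE; apply: bl_leZl => //; lra.
Qed.

(** Preimages under a Borel function are Borel, hence Caratheodory
    measurable. *)
Lemma measurable_gauge_borel (R : realType) (g : R -> R) :
  (forall t, t \in `[0, 1] -> 0 < g t) ->
  measurable_fun setT (g : measurableTypeR R -> measurableTypeR R) ->
  measurable_gauge g.
Proof.
move=> g0 mg; split => // mI Y mY; apply: measurableI => //.
by apply: sub_caratheodory; rewrite -[X in measurable X]setTI; exact: mg.
Qed.

Lemma dist_gauge_measurable (R : realType) (U S : set R) :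
  open U -> ~` U !=set0 -> closed S -> S !=set0 -> S `<=` U ->
  measurable_gauge
    (fun t => if t \in U then dist_set (~` U) t else dist_set S t).
Proof.
move=> oU U0 cS S0 SU; apply: measurable_gauge_borel => [t _|].
  case: ifPn => [|/negP]; rewrite inE => Ut.
    by apply: dist_set_gt0 => //; exact: open_closedC.
  by apply: dist_set_gt0 => // /SU.
apply: measurable_fun_ifT.
- apply: (measurable_fun_bool true); rewrite setTI.
  rewrite [X in measurable X](_ : _ = U); first exact: open_measurable.
  by apply/seteqP; split=> t /=; [exact: set_mem|exact: mem_set].
- by apply: continuous_measurable_fun; exact: dist_set_continuous.
- by apply: continuous_measurable_fun; exact: dist_set_continuous.
Qed.

(** A point w outside [a, b] would be separated from t by a or b, hence be at
    least as far from t as S is. *)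
Lemma fine_sub_cell (R : realType) (S E : set R) (t a b : R) :
  S a -> S b -> a <= t <= b -> (forall w, E w -> `|w - t| < dist_set S t) ->
  E `<=` `[a, b]%classic.
Proof.
move=> Sa Sb /andP[a_t tb] Et w /Et wt /=; rewrite in_itv/=.
have := lt_le_trans wt (dist_set_le t Sa).
have := lt_le_trans wt (dist_set_le t Sb).
rewrite (ger0_norm (_ : 0 <= t - a)) ?subr_ge0// distrC.
rewrite (distrC t b) (ger0_norm (_ : 0 <= b - t)) ?subr_ge0//.
rewrite !ltr_norml => /andP[h1 h2] /andP[h3 h4].
by apply/andP; split; lra.
Qed.

(** The case of a single gauge: a gauge good for Perron-type partitions can be
    replaced by one good for free partitions at the price e *: M. *)
Lemma free_gauge_of_perron_gauge (R : realType) (X : banachLatticeType R)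
    (f : R -> X) (M J p : X) (g : R -> R) (e : R) :
  (forall t, t \in `[0, 1] -> modulus (f t) <= M) ->
  measurable_gauge g -> 0 < e ->
  (forall k (t : 'I_k -> R) (E : 'I_k -> set R),
    perron_partition t E -> gauge_fine g t E ->
    modulus (riemann_sum f t E - J) <= p) ->
  exists g', measurable_gauge g' /\
    forall k (t : 'I_k -> R) (E : 'I_k -> set R),
      free_partition t E -> gauge_fine g' t E ->
      modulus (riemann_sum f t E - J) <= p + e *: M.
Proof.
move=> fM gm e0 gp.
have M0 : 0 <= M.
  by apply: le_trans (modulus_ge0 (f 0)) (fM _ _); rewrite in_itv/= lexx ler01.
have e4 : 0 < e / 4 by rewrite divr_gt0.
have [c c0 Ac] := small_gauge_set gm e4.
set A := [set t | _] in Ac.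
have [|N [x [s [x0 xN xs xg]]]] := @cousin_division _ (fun t => Num.min (g t) c).
  by move=> t t01; rewrite lt_min c0 andbT; exact: gm.1.
pose S := [set x j | j in `I_N.+1].
have fS : finite_set S by apply: finite_image; exact: finite_II.
have Sx j : (j <= N)%N -> S (x j) by move=> jN; exists j.
have [U [oU AU SU Ue U0]] := small_open_cover e4 Ac (finite_set_countable fS).
exists (fun t => if t \in U then dist_set (~` U) t else dist_set S t); split.
  apply: dist_gauge_measurable => //; last by exists (x 0%N); exact: Sx.
  exact/(accessible_finite_set_closed.1 _ _ fS)/hausdorff_accessible/Rhausdorff.
move=> k t E fE gE; have [t01 _ _ _] := fE.
pose I (j : 'I_N) : set R := `[x j, x j.+1]%classic.
have N0 : (0 < N)%N.
  rewrite lt0n; apply/eqP => N0; move: xN.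
  by rewrite N0 x0 => /eqP; rewrite eq_sym oner_eq0.
(* Only pieces with tag outside U are sent to a meaningful cell. *)
have /choice[h hP] : forall i, exists j : 'I_N, ~ U (t i) ->
    E i `<=` I j /\ x j <= t i <= x j.+1.
  move=> i; have [Ui|nUi] := pselect (U (t i)); first by exists (Ordinal N0).
  have : x 0%N <= t i < x N.
    have := t01 i; rewrite in_itv/= x0 => /andP[-> ti1]/=.
    rewrite lt_neqAle {2}xN ti1 andbT; apply/eqP => tx.
    by apply/nUi/SU; rewrite tx; exact: Sx.
  move=> /division_cover[j jN /andP[xj jx]]; exists (Ordinal jN) => _.
  have xt : x j <= t i <= x j.+1 by rewrite xj ltW.
  split => //; apply: (@fine_sub_cell _ S _ (t i)) => //; [|exact: Sx|].
    by apply: Sx; exact: ltnW.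
  by move=> w /gE; rewrite memNset.
have EU i : U (t i) -> E i `<=` U.
  move=> Ui w /gE; rewrite mem_set// => wt; apply: contrapT => nUw.
  by have := lt_le_trans wt (dist_set_le (t i) nUw); rewrite distrC ltxx.
have sx (j : 'I_N) : x j <= s j <= x j.+1 by exact: xs.
have fI : free_partition (fun j : 'I_N => s j) I.
  exact: (division_perron x0 xN xs sx).1.
have Ifin := free_partition_fin_num fI.
pose len (B : set R) := fine (lebesgue_measure B).
pose good i := t i \notin U.
have goodP i : good i -> ~ U (t i).
  by move=> /negP gi Ui; apply: gi; exact: mem_set.
have retag a : (forall j : 'I_N,
    a j = s j \/ exists i, [/\ good i, h i = j & a j = t i]) ->
    modulus (riemann_sum f a I - J) <= p.
  move=> aP.
  have ax (j : 'I_N) : x j <= a j <= x j.+1.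
    have [->//|[i [gi <- ->]]] := aP j.
    by apply: (hP i _).2; exact: goodP.
  apply: gp; first exact: division_perron x0 xN xs a ax.
  move=> j w; rewrite /I/= in_itv/= => /andP[xw wx].
  apply: (@le_lt_trans _ _ (x j.+1 - x j)).
    by case/andP: (ax j) => *; rewrite ler_norml; apply/andP; split; lra.
  have := xg j (ltn_ord j); rewrite lt_min => /andP[xgs xc].
  have [->//|[i [gi _ ->]]] := aP j.
  apply: (lt_le_trans xc); rewrite leNgt; apply/negP => gc.
  by apply: (goodP i gi); apply: AU; split.
(* F will be f, with B = J + p, and - f, with B = p - J. *)
have main (F : R -> X) (B : X) :
    (forall r, r \in `[0, 1] -> F r <= M) ->
    (forall r, r \in `[0, 1] -> - F r <= M) ->
    (forall a : 'I_N -> R, (forall j,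
       a j = s j \/ exists i, [/\ good i, h i = j & a j = t i]) ->
       \sum_j len (I j) *: F (a j) <= B) ->
    \sum_i len (E i) *: F (t i) <= B + e *: M.
  move=> FM NFM FB.
  (* U has measure at most 2 * (e / 4), and two corrections are made. *)
  have -> : e = 2 * (2 * (e / 4)) by lra.
  apply: (@retagged_sum_le _ _ F M B _ N k (fun j => len (I j))
    (fun j => s j) (fun i => len (E i)) t h good) => //.
  - by move=> i; exact: fine_ge0.
  - move=> j; rewrite -lee_fin /len (fineK (Ifin j)).
    apply: free_partition_sum_length_le fE _ _; first exact: measurable_itv.
    by move=> i /andP[gi /eqP <-]; apply: (hP i _).1; exact: goodP.
  - by rewrite !(free_partition_total_length fI, free_partition_total_length fE).
  - rewrite -lee_fin; apply: le_trans Ue.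
    apply: free_partition_sum_length_le fE _ _; first exact: open_measurable.
    by move=> i; rewrite negbK inE; exact: EU.
  - by move=> i; apply: FM.
  - move=> j; apply: NFM; case: fI => + _ _ _; exact.
have fM2 r : r \in `[0, 1] -> (f r <= M) && (- f r <= M).
  by move=> /fM; rewrite modulus_le.
rewrite modulus_le; apply/andP; split.
  rewrite bl_leBlDr addrAC; apply: main => [r /fM2/andP[]//|r /fM2/andP[]//|a aP].
  by rewrite -bl_leBlDr; have := retag a aP; rewrite modulus_le => /andP[].
rewrite opprB addrC -bl_leBrDr addrAC /riemann_sum -sumrN.
under eq_bigr do rewrite -scalerN.
apply: (main (fun r => - f r)) => [r /fM2/andP[]//|r|a aP].
  by rewrite opprK => /fM2/andP[].
under eq_bigr do rewrite scalerN.
rewrite sumrN bl_leBrDr addrC -opprB.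
by have := retag a aP; rewrite modulus_le => /andP[].
Qed.

Theorem mainTheorem1 (R : realType) (X : banachLatticeType R)
    (hX : order_continuous_norm X) (f : R -> X)
    (hf : exists M : X, forall t : R, t \in `[0, 1] -> modulus (f t) <= M) :
  oBH_integrable f <-> oB_integrable f.
Proof.
split=> [[J [p [g [op gm gp]]]]|[J [p [g [op gm gp]]]]]; last first.
  by exists J, p, g; split => // n k t E [fE _]; exact: gp.
have [M fM] := hf.
have M0 : 0 <= M.
  by apply: le_trans (modulus_ge0 (f 0)) (fM _ _); rewrite in_itv/= lexx ler01.
have step n : exists g', measurable_gauge g' /\
    forall k (t : 'I_k -> R) (E : 'I_k -> set R),
      free_partition t E -> gauge_fine g' t E ->
      modulus (riemann_sum f t E - J) <= p n + n.+1%:R^-1 *: M.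
  by apply: free_gauge_of_perron_gauge (gp n) => //; rewrite invr_gt0.
have [g' g'P] := choice step.
exists J, (fun n => p n + n.+1%:R^-1 *: M), g'; split.
- exact: o_sequenceD op (o_sequence_harmonic M0).
- by move=> n; exact: (g'P n).1.
- by move=> n; exact: (g'P n).2.
Qed.
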